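(* Let $\mathfrak g,\mathfrak h$ be finite-dimensional Lie algebras over a field $K$ and let $r_{\mathfrak g}\in\mathfrak g\otimes\mathfrak g$, $r_{\mathfrak h}\in\mathfrak h\otimes\mathfrak h$ be classical $r$-matrices in $\mathfrak g$ and $\mathfrak h$ respectively, each satisfying the invariance condition $(\mathrm{ad}(x)\otimes\mathrm{id}+\mathrm{id}\otimes\mathrm{ad}(x))(r+\tau(r))=0$ for all $x$ in the corresponding Lie algebra, where $\tau$ is the flip map. If $(\phi,\psi)$ is a coherent homomorphism of classical $r$-matrices from $r_{\mathfrak g}$ to $r_{\mathfrak h}$, then $(\phi,\psi)$ is a coherent homomorphism of the corresponding Lie bialgebras from $(\mathfrak g,[\,,]_{\mathfrak g},\delta_{r_{\mathfrak g}})$ to $(\mathfrak h,[\,,]_{\mathfrak h},\delta_{r_{\mathfrak h}})$. This correspondence ($r_{\mathfrak g}\mapsto(\mathfrak g,[\,,]_{\mathfrak g},\delta_{r_{\mathfrak g}})$ on objects, $(\phi,\psi)\mapsto(\phi,\psi)$ on morphisms) defines a functor from the category $\mathbf{Crs}$ of classical $r$-matrices $r$ (in finite-dimensional Lie algebras $\mathfrak a$) satisfying $(\mathrm{ad}(x)\otimes\mathrm{id}+\mathrm{id}\otimes\mathrm{ad}(x))(r+\tau(r))=0$ for all $x\in\mathfrak a$ (a full subcategory of the category $\mathbf{Cr}$ of classical $r$-matrices) to the category $\mathbf{QTLB}$ of quasi-triangular Lie bialgebras (a full subcategory of the category $\mathbf{LB}$ of Lie bialgebras with coherent homomorphisms)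.
   Context: For $r=\sum_i a_i\otimes b_i\in\mathfrak g\otimes\mathfrak g$ put $[r_{12},r_{13}]=\sum_{i,j}[a_i,a_j]\otimes b_i\otimes b_j$, $[r_{13},r_{23}]=\sum_{i,j}a_i\otimes a_j\otimes[b_i,b_j]$, $[r_{12},r_{23}]=\sum_{i,j}a_i\otimes[b_i,a_j]\otimes b_j$. A classical $r$-matrix in $\mathfrak g$ is a solution $r\in\mathfrak g\otimes\mathfrak g$ of the classical Yang-Baxter equation $[r_{12},r_{13}]+[r_{13},r_{23}]+[r_{12},r_{23}]=0$. For $r\in\mathfrak g\otimes\mathfrak g$ define $\delta_r:\mathfrak g\to\mathfrak g\otimes\mathfrak g$ by $\delta_r(x)=(\mathrm{id}\otimes\mathrm{ad}(x)+\mathrm{ad}(x)\otimes\mathrm{id})(r)$. It is known that if $r$ is a classical $r$-matrix satisfying $(\mathrm{ad}(x)\otimes\mathrm{id}+\mathrm{id}\otimes\mathrm{ad}(x))(r+\tau(r))=0$ for all $x\in\mathfrak g$, where $\tau$ is the flip map, then $(\mathfrak g,[\,,],\delta_r)$ is a Lie bialgebra; Lie bialgebras arising in this way from a classical $r$-matrix are called quasi-triangular. Coherent homomorphism of classical $r$-matrices from $r_{\mathfrak g}$ to $r_{\mathfrak h}$: a pair $(\phi,\psi)$ with $\phi:\mathfrak g\to\mathfrak h$ a Lie algebra homomorphism and $\psi:\mathfrak h\to\mathfrak g$ a linear map such that $(\psi\otimes\mathrm{id}_{\mathfrak h})(r_{\mathfrak h})=(\mathrm{id}_{\mathfrak g}\otimes\phi)(r_{\mathfrak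 g})$, $(\mathrm{id}_{\mathfrak h}\otimes\psi)(r_{\mathfrak h})=(\phi\otimes\mathrm{id}_{\mathfrak g})(r_{\mathfrak g})$, and $\psi[\phi(x),y]_{\mathfrak h}=[x,\psi(y)]_{\mathfrak g}$ for all $x\in\mathfrak g,y\in\mathfrak h$. The category $\mathbf{Cr}$ has as objects classical $r$-matrices (in finite-dimensional Lie algebras) and these pairs as morphisms. Lie coalgebra: $(\mathfrak g,\delta)$ with $\delta=-\tau\delta$ and $(\mathrm{id}+\sigma+\sigma^2)(\mathrm{id}\otimes\delta)\delta=0$, where $\sigma(x\otimes y\otimes z)=z\otimes x\otimes y$. Lie bialgebra: $(\mathfrak g,[\,,],\delta)$ with $(\mathfrak g,[\,,])$ a Lie algebra, $(\mathfrak g,\delta)$ a Lie coalgebra and $\delta[x,y]=(\mathrm{ad}(x)\otimes\mathrm{id}+\mathrm{id}\otimes\mathrm{ad}(x))\delta(y)-(\mathrm{ad}(y)\otimes\mathrm{id}+\mathrm{id}\otimes\mathrm{ad}(y))\delta(x)$. Coherent homomorphism of Lie bialgebras from $(\mathfrak g,[\,,]_{\mathfrak g},\delta_{\mathfrak g})$ to $(\mathfrak h,[\,,]_{\mathfrak h},\delta_{\mathfrak h})$: a pair $(\phi,\psi)$ where $\phi:\mathfrak g\to\mathfrak h$ is a Lie algebra homomorphism, $\psi:\mathfrak h\to\mathfrak g$ is linear with $(\psi\otimes\psi)\delta_{\mathfrak h}=\delta_{\mathfrak g}\psi$, $(\mathrm{id}_{\mathfrak g}\otimes\phi)\delta_{\mathfrak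 g}=(\psi\otimes\mathrm{id}_{\mathfrak h})\delta_{\mathfrak h}\phi$, and $\psi[\phi(x),y]_{\mathfrak h}=[x,\psi(y)]_{\mathfrak g}$ for all $x\in\mathfrak g,y\in\mathfrak h$. $\mathbf{LB}$ is the category of Lie bialgebras with these morphisms. In both categories composition is $(\phi_2,\psi_2)(\phi_1,\psi_1)=(\phi_2\phi_1,\psi_1\psi_2)$. *)

(* Defs.v *)
From HB Require Import structures.
From mathcomp Require Import all_boot all_order all_algebra.
From mathcomp Require Import boolp.

Set Implicit Arguments.
Unset Strict Implicit.
Unset Printing Implicit Defensive.

Import GRing.Theory.
Local Open Scope ring_scope.
Local Open Scope quotient_scope.

Section Tensor.
Variables (K : fieldType) (U V : lmodType K).

(* A list [:: (u1, v1); ...; (un, vn)] stands for u1 ⊗ v1 + ... + un ⊗ vn;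
   [tens_eqv] is the congruence generated by the bilinearity relations.  The
   scalars are absorbed in the factors. *)
Inductive tens_eqv : seq (U * V) -> seq (U * V) -> Prop :=
| tens_refl s : tens_eqv s s
| tens_sym s t : tens_eqv s t -> tens_eqv t s
| tens_trans s t w : tens_eqv s t -> tens_eqv t w -> tens_eqv s w
| tens_comm s t : tens_eqv (s ++ t) (t ++ s)
| tens_cat s1 s2 t1 t2 :
    tens_eqv s1 t1 -> tens_eqv s2 t2 -> tens_eqv (s1 ++ s2) (t1 ++ t2)
| tens_addl u u' v : tens_eqv [:: (u + u', v)] [:: (u, v); (u', v)]
| tens_addr u v v' : tens_eqv [:: (u, v + v')] [:: (u, v); (u, v')]
| tens_scale k u v : tens_eqv [:: (k *: u, v)] [:: (u, k *: v)]
| tens_zero v : tens_eqv [:: (0, v)] [::].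

Definition tens_rel : rel (seq (U * V)) := fun s t => `[< tens_eqv s t >].

Fact tens_rel_refl : reflexive tens_rel.
Proof. by move=> s; apply/asboolP/tens_refl. Qed.

Fact tens_rel_sym : symmetric tens_rel.
Proof. by move=> s t; apply/asboolP/asboolP; apply: tens_sym. Qed.

Fact tens_rel_trans : transitive tens_rel.
Proof.
move=> t s w /asboolP st /asboolP tw; apply/asboolP; exact: tens_trans st tw.
Qed.

Canonical tens_equiv_rel := EquivRel tens_rel
  tens_rel_refl tens_rel_sym tens_rel_trans.

Definition tensor : Type := {eq_quot tens_rel}.
HB.instance Definition _ := Choice.on tensor.
HB.instance Definition _ := EqQuotient.on tensor.

Let scl (k : K) (s : seq (U * V)) := [seq (k *: p.1, p.2) | p <- s].

Definition tens_add (x y : tensor) : tensor := \pi_tensor (repr x ++ repr y).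
Definition tens_scl (k : K) (x : tensor) : tensor := \pi_tensor (scl k (repr x)).
Definition tens_nul : tensor := \pi_tensor [::].
Definition tens_opp (x : tensor) : tensor := tens_scl (-1) x.

Let piP s t : tens_eqv s t <-> \pi_tensor s = \pi_tensor t.
Proof.
split=> [h|/eqP]; first by apply/eqP; rewrite piE; apply/asboolP.
by rewrite piE => /asboolP.
Qed.

Let tens_eqv_repr s : tens_eqv (repr (\pi_tensor s)) s.
Proof. by apply/piP; rewrite reprK. Qed.

Let pi_add s t : tens_add (\pi_tensor s) (\pi_tensor t) = \pi_tensor (s ++ t).
Proof. by apply/piP/tens_cat; apply: tens_eqv_repr. Qed.

Let scl_eqv k s t : tens_eqv s t -> tens_eqv (scl k s) (scl k t).
Proof.
elim=> {s t} [s|s t _|s t w _ h1 _ h2|s t|s1 s2 t1 t2 _ h1 _ h2|u u' v|u v v'|l u v|v].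
- exact: tens_refl.
- exact: tens_sym.
- exact: tens_trans h1 h2.
- by rewrite /scl !map_cat; apply: tens_comm.
- by rewrite /scl !map_cat; apply: tens_cat.
- by rewrite /= scalerDr; apply: tens_addl.
- exact: tens_addr.
- by rewrite /= scalerA mulrC -scalerA; apply: tens_scale.
- by rewrite /= scaler0; apply: tens_zero.
Qed.

Let pi_scl k s : tens_scl k (\pi_tensor s) = \pi_tensor (scl k s).
Proof. by apply/piP/scl_eqv/tens_eqv_repr. Qed.

Let tensorW (P : tensor -> Prop) : (forall s, P (\pi_tensor s)) -> forall x, P x.
Proof. by move=> h x; rewrite -[x]reprK; apply: h. Qed.

Let addA : associative tens_add.
Proof.
elim/tensorW=> s; elim/tensorW=> t; elim/tensorW=> w.
by rewrite !pi_add catA.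
Qed.

Let addC : commutative tens_add.
Proof.
elim/tensorW=> s; elim/tensorW=> t.
by rewrite !pi_add; apply/piP/tens_comm.
Qed.

Let add0 : left_id tens_nul tens_add.
Proof. by elim/tensorW=> s; rewrite pi_add. Qed.

Let sclDl x k l : tens_scl (k + l) x = tens_add (tens_scl k x) (tens_scl l x).
Proof.
elim/tensorW: x => s; rewrite !pi_scl pi_add; apply/piP.
elim: s => [|[u v] s ih] /=; first exact: tens_refl.
apply: (@tens_trans _ ([:: (k *: u, v); (l *: u, v)] ++ (scl k s ++ scl l s))).
  by rewrite -cat1s; apply: tens_cat => //; rewrite scalerDl; apply: tens_addl.
rewrite -[X in tens_eqv _ X]cat1s -cat1s -catA.
apply: tens_cat; first exact: tens_refl.
rewrite -[X in tens_eqv _ (_ ++ X)]cat1s !catA.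
by apply: tens_cat; [apply: tens_comm | apply: tens_refl].
Qed.

Let scl0 x : tens_scl 0 x = tens_nul.
Proof.
elim/tensorW: x => s; rewrite pi_scl; apply/piP.
elim: s => [|[u v] s ih] /=; first exact: tens_refl.
rewrite -cat1s -[X in tens_eqv _ X]cat0s scale0r.
by apply: tens_cat => //; apply: tens_zero.
Qed.

Let scl1 : left_id 1 tens_scl.
Proof.
elim/tensorW=> s; rewrite pi_scl; congr (\pi_tensor _).
by elim: s => [|[u v] s ih] //=; rewrite scale1r ih.
Qed.

Let addN : left_inverse tens_nul tens_opp tens_add.
Proof. by move=> x; rewrite -{2}[x]scl1 -sclDl addNr scl0. Qed.

HB.instance Definition _ := GRing.isZmodule.Build tensor addA addC add0 addN.

Let sclA k l x : tens_scl k (tens_scl l x) = tens_scl (k * l) x.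
Proof.
elim/tensorW: x => s; rewrite !pi_scl; congr (\pi_tensor _).
by rewrite /scl -map_comp; apply: eq_map => -[u v] /=; rewrite scalerA.
Qed.

Let sclDr : right_distributive tens_scl +%R.
Proof.
move=> k; elim/tensorW=> s; elim/tensorW=> t.
by rewrite [_ + _]pi_add !pi_scl [RHS]pi_add /scl map_cat.
Qed.

HB.instance Definition _ := GRing.Zmodule_isLmodule.Build K tensor
  sclA scl1 sclDr (fun x k l => sclDl x k l).

Definition tens (u : U) (v : V) : tensor := \pi_tensor [:: (u, v)].

Lemma tensDl u u' v : tens (u + u') v = tens u v + tens u' v.
Proof. by rewrite [RHS]pi_add; apply/piP/tens_addl. Qed.

Lemma tensDr u v v' : tens u (v + v') = tens u v + tens u v'.
Proof. by rewrite [RHS]pi_add; apply/piP/tens_addr. Qed.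

Lemma tensZl k u v : tens (k *: u) v = k *: tens u v.
Proof. by rewrite [RHS]pi_scl. Qed.

Lemma tensZr k u v : tens u (k *: v) = k *: tens u v.
Proof. by rewrite -tensZl; apply/esym/piP/tens_scale. Qed.

Lemma tens_linearl v : linear (tens^~ v).
Proof. by move=> k u u'; rewrite tensDl tensZl. Qed.

Lemma tens_linearr u : linear (tens u).
Proof. by move=> k v v'; rewrite tensDr tensZr. Qed.

HB.instance Definition _ u := GRing.isLinear.Build K V tensor *:%R (tens u)
  (tens_linearr u).

Let pi_sum s : \pi_tensor s = \sum_(p <- s) tens p.1 p.2.
Proof.
elim: s => [|[u v] s ih]; first by rewrite big_nil.
by rewrite big_cons -ih [RHS]pi_add.
Qed.

Lemma tensE x : x = \sum_(p <- repr x) tens p.1 p.2.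
Proof. by rewrite -pi_sum reprK. Qed.

Lemma tensP (P : tensor -> Prop) :
  P 0 -> (forall x y, P x -> P y -> P (x + y)) ->
  (forall u v, P (tens u v)) -> forall x, P x.
Proof. by move=> P0 PD PT x; rewrite [x]tensE; elim/big_ind: _. Qed.

Variable W : lmodType K.

(* The map induced on tensors by B; only meaningful for a bilinear B. *)
Definition tlift (B : U -> V -> W) (x : tensor) : W :=
  \sum_(p <- repr x) B p.1 p.2.

Section Lift.
Variable B : U -> V -> W.
Hypotheses (Bl : forall v, linear (B^~ v)) (Br : forall u, linear (B u)).

Let BZl k u v : B (k *: u) v = k *: B u v.
Proof.
have B0 : B 0 v = 0 by have := Bl v (-1) 0 0; rewrite scaler0 addr0 scaleN1r addNr.
by have := Bl v k u 0; rewrite B0 !addr0.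
Qed.

Let BZr k u v : B u (k *: v) = k *: B u v.
Proof.
have B0 : B u 0 = 0 by have := Br u (-1) 0 0; rewrite scaler0 addr0 scaleN1r addNr.
by have := Br u k v 0; rewrite B0 !addr0.
Qed.

Let BDl u u' v : B (u + u') v = B u v + B u' v.
Proof. by have := Bl v 1 u u'; rewrite !scale1r. Qed.

Let BDr u v v' : B u (v + v') = B u v + B u v'.
Proof. by have := Br u 1 v v'; rewrite !scale1r. Qed.

Let tlift_pi s : tlift B (\pi_tensor s) = \sum_(p <- s) B p.1 p.2.
Proof.
suff eqv_sum s1 s2 : tens_eqv s1 s2 ->
    \sum_(p <- s1) B p.1 p.2 = \sum_(p <- s2) B p.1 p.2.
  exact/eqv_sum/tens_eqv_repr.
elim=> {s1 s2} [|s1 s2 _ ->|s1 s2 s3 _ -> _ ->|s1 s2|s1 s2 t1 t2 _ h1 _ h2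
  |u u' v|u v v'|l u v|v] //.
- by rewrite !big_cat; apply: addrC.
- by rewrite !big_cat /= h1 h2.
- by rewrite !big_cons !big_nil !addr0 BDl.
- by rewrite !big_cons !big_nil !addr0 BDr.
- by rewrite !big_cons !big_nil !addr0 BZl BZr.
- by rewrite !big_cons !big_nil addr0 /= -(scale0r (0 : U)) BZl scale0r.
Qed.

Lemma tlift_tens u v : tlift B (tens u v) = B u v.
Proof. by rewrite tlift_pi big_seq1. Qed.

Lemma tlift_linear : linear (tlift B).
Proof.
move=> k; elim/tensorW=> s; elim/tensorW=> t.
rewrite [k *: _]pi_scl [X in tlift _ X]pi_add !tlift_pi big_cat /=.
by rewrite big_map scaler_sumr; congr (_ + _); apply: eq_bigr => p _ /=.
Qed.

End Lift.
End Tensor.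

Arguments tensor {K} (U V)%_type_scope.
Notation "U ⊗ V" := (tensor U V) (at level 35, right associativity) : type_scope.
Notation "u ⊗ v" := (tens u v) (at level 35, right associativity) : ring_scope.

Arguments tens {K U V}.
Arguments tlift {K U V W}.

Section TensorTheory.
Variable K : fieldType.
Implicit Types U V W : lmodType K.

Lemma tens_ext U V W (f g : U ⊗ V -> W) : linear f -> linear g ->
  (forall u v, f (u ⊗ v) = g (u ⊗ v)) -> f =1 g.
Proof.
move=> fl gl fg.
have z (h : U ⊗ V -> W) : linear h -> h 0 = 0.
  by move=> hl; have := hl (-1) 0 0; rewrite scaler0 addr0 scaleN1r addNr.
have a (h : U ⊗ V -> W) : linear h -> {morph h : x y / x + y}.
  by move=> hl x y; have := hl 1 x y; rewrite !scale1r.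
elim/tensP=> // [|x y hx hy]; first by rewrite !z.
by rewrite !a // hx hy.
Qed.

Definition tmap U V U' V' (f : {linear U -> U'}) (g : {linear V -> V'})
  (x : U ⊗ V) : U' ⊗ V' := tlift (fun u v => f u ⊗ g v) x.

Section Tmap.
Variables (U V U' V' : lmodType K).
Variables (f : {linear U -> U'}) (g : {linear V -> V'}).

Let tmap_l v : linear (fun u => f u ⊗ g v).
Proof. by move=> k a b; rewrite linearP tens_linearl. Qed.

Let tmap_r u : linear (fun v => f u ⊗ g v).
Proof. by move=> k a b; rewrite !linearP. Qed.

Lemma tmap_tens u v : tmap f g (u ⊗ v) = f u ⊗ g v.
Proof. exact: tlift_tens. Qed.

Fact tmap_linear : linear (tmap f g). Proof. exact: tlift_linear. Qed.

HB.instance Definition _ := GRing.isLinear.Build K (U ⊗ V)%type (U' ⊗ V')%type *:%R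
  (tmap f g) tmap_linear.
End Tmap.

Definition tflip U V (x : U ⊗ V) : V ⊗ U := tlift (fun u v => v ⊗ u) x.

Lemma tflip_tens U V (u : U) (v : V) : tflip (u ⊗ v) = v ⊗ u.
Proof.
by apply: tlift_tens => [w|w]; [apply: tens_linearr | apply: tens_linearl].
Qed.

Fact tflip_linear U V : linear (@tflip U V).
Proof.
by apply: tlift_linear => [w|w]; [apply: tens_linearr | apply: tens_linearl].
Qed.

HB.instance Definition _ U V := GRing.isLinear.Build K (U ⊗ V)%type (V ⊗ U)%type *:%R
  (@tflip U V) (@tflip_linear U V).

Definition trot U (x : U ⊗ U ⊗ U) : U ⊗ U ⊗ U :=
  tlift (fun a => tlift (fun b c => c ⊗ a ⊗ b)) x.

Section Trot.
Variable U : lmodType K.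

Let rot_l a c : linear (fun b : U => (c : U) ⊗ (a : U) ⊗ b).
Proof. by move=> k x y; rewrite !linearP. Qed.

Let rot_r a b : linear (fun c : U => c ⊗ (a : U) ⊗ (b : U)).
Proof. by move=> k x y; rewrite tens_linearl. Qed.

Let rot2_l t : linear (fun a => tlift (fun b c : U => c ⊗ (a : U) ⊗ b) t).
Proof.
move=> k a a'; pose f z t := tlift (fun b c : U => c ⊗ (z : U) ⊗ b) t.
have fl z : linear (f z) by apply: tlift_linear.
have ft z b c : f z (b ⊗ c) = c ⊗ z ⊗ b by apply: tlift_tens.
move: t; apply: (@tens_ext _ _ _ (f _) (fun t => k *: f a t + f a' t)) => //.
  by move=> l x y; rewrite !fl !scalerDr !scalerA mulrC addrACA.
by move=> b c; rewrite !ft tens_linearl linearP.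
Qed.

Lemma trot_tens a b c : trot (a ⊗ b ⊗ c) = (c : U) ⊗ a ⊗ b.
Proof.
rewrite /trot tlift_tens //; first exact: tlift_tens.
by move=> u; apply: tlift_linear.
Qed.

Fact trot_linear : linear (@trot U).
Proof. by apply: tlift_linear => // u; apply: tlift_linear. Qed.

HB.instance Definition _ := GRing.isLinear.Build K (U ⊗ U ⊗ U)%type (U ⊗ U ⊗ U)%type *:%R
  (@trot U) trot_linear.
End Trot.

Section Lift2.
Variables (U V U' V' W : lmodType K) (F : U -> V -> U' -> V' -> W).
Hypotheses (F1 : forall b c d, linear (fun a => F a b c d))
           (F2 : forall a c d, linear (fun b => F a b c d))
           (F3 : forall a b d, linear (fun c => F a b c d))
           (F4 : forall a b c, linear (F a b c)).

Let G s a b := tlift (F a b) s.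

Let G_r a b : linear (fun s => G s a b).
Proof. exact: tlift_linear. Qed.

Let G_tens a b c d : G (c ⊗ d) a b = F a b c d.
Proof. exact: tlift_tens. Qed.

Let G_comb s k a b a' b' a'' b'' :
  (forall c d, F a b c d = k *: F a' b' c d + F a'' b'' c d) ->
  G s a b = k *: G s a' b' + G s a'' b''.
Proof.
move=> h; move: s.
suff: (fun s => G s a b) =1 (fun s => k *: G s a' b' + G s a'' b'') by apply.
apply: tens_ext => [//|l x y|c d]; last by rewrite !G_tens.
by rewrite !G_r !scalerDr !scalerA mulrC addrACA.
Qed.

Let G_1 s b : linear (fun a => G s a b).
Proof. by move=> k a a'; apply: G_comb => c d; apply: F1. Qed.

Let G_2 s a : linear (G s a).
Proof. by move=> k b b'; apply: G_comb => c d; apply: F2. Qed.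

Definition tlift2 (r : U ⊗ V) (s : U' ⊗ V') : W :=
  tlift (fun a b => tlift (F a b) s) r.

Lemma tlift2_tens a b c d : tlift2 (a ⊗ b) (c ⊗ d) = F a b c d.
Proof. by rewrite -G_tens /tlift2 (@tlift_tens _ _ _ _ (G _)). Qed.

Lemma tlift2_linearl s : linear (tlift2^~ s).
Proof. exact: (@tlift_linear _ _ _ _ (G s)). Qed.

Lemma tlift2_linearr r : linear (tlift2 r).
Proof.
move=> k s t; move: r.
suff: (fun r => tlift2 r (k *: s + t)) =1
  (fun r => k *: tlift2 r s + tlift2 r t) by apply.
apply: tens_ext => [|l x y|a b]; first exact: tlift2_linearl.
  by rewrite !tlift2_linearl !scalerDr !scalerA mulrC addrACA.
by rewrite /tlift2 !(@tlift_tens _ _ _ _ (G _)) // G_r.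
Qed.

End Lift2.

End TensorTheory.

HB.mixin Record isLieAlgebra (K : fieldType) L of GRing.Lmodule K L := {
  lie : L -> L -> L;
  lie_linearl : forall y, linear (lie^~ y);
  lie_linearr : forall x, linear (lie x);
  liexx : forall x, lie x x = 0;
  lie_jacobi : forall x y z,
    lie x (lie y z) + lie y (lie z x) + lie z (lie x y) = 0
}.

#[short(type="lieAlgType")]
HB.structure Definition LieAlgebra (K : fieldType) :=
  {L of GRing.Lmodule K L & isLieAlgebra K L}.

#[short(type="fdLieAlgType")]
HB.structure Definition FdLieAlgebra (K : fieldType) :=
  {L of Vector K L & isLieAlgebra K L}.

Notation "⁅ x , y ⁆" := (lie x y) (at level 0, format "⁅ x ,  y ⁆") : ring_scope.

Section LieDefs.
Variable K : fieldType.
Implicit Types g h : lieAlgType K.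

Definition ad g (x : g) : g -> g := lie x.

HB.instance Definition _ g (x : g) := GRing.isLinear.Build K g g *:%R (ad x)
  (lie_linearr x).

Definition is_lie_hom g h (phi : {linear g -> h}) : Prop :=
  forall x y, phi ⁅x, y⁆ = ⁅phi x, phi y⁆.

(* For r = \sum_i a_i ⊗ b_i and s = \sum_j c_j ⊗ d_j, these are respectively
   \sum_(i, j) [a_i, c_j] ⊗ b_i ⊗ d_j, \sum_(i, j) a_i ⊗ c_j ⊗ [b_i, d_j] and
   \sum_(i, j) a_i ⊗ [b_i, c_j] ⊗ d_j. *)
Definition br12_13 g (r s : g ⊗ g) : g ⊗ g ⊗ g :=
  tlift2 (fun a b c d => ⁅a, c⁆ ⊗ b ⊗ d) r s.
Definition br13_23 g (r s : g ⊗ g) : g ⊗ g ⊗ g :=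
  tlift2 (fun a b c d => a ⊗ c ⊗ ⁅b, d⁆) r s.
Definition br12_23 g (r s : g ⊗ g) : g ⊗ g ⊗ g :=
  tlift2 (fun a b c d => a ⊗ ⁅b, c⁆ ⊗ d) r s.

Definition is_classical_rmatrix g (r : g ⊗ g) : Prop :=
  br12_13 r r + br13_23 r r + br12_23 r r = 0.

Definition has_invariant_sym g (r : g ⊗ g) : Prop :=
  forall x : g, tmap (ad x) idfun (r + tflip r) + tmap idfun (ad x) (r + tflip r) = 0.

Definition delta_r g (r : g ⊗ g) (x : g) : g ⊗ g :=
  tmap idfun (ad x) r + tmap (ad x) idfun r.

Fact delta_r_linear g (r : g ⊗ g) : linear (delta_r r).
Proof.
move=> k x y.
suff: (fun s : g ⊗ g => delta_r s (k *: x + y)) =1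
      (fun s => k *: delta_r s x + delta_r s y) by apply.
have dl z : linear (fun s : g ⊗ g => delta_r s z).
  by move=> l a b; rewrite /delta_r !linearP !scalerDr addrACA.
apply: tens_ext => [//|l a b|a b].
  by rewrite !dl !scalerDr !scalerA mulrC addrACA.
rewrite /delta_r !tmap_tens /= /ad !lie_linearl linearP tens_linearl.
by rewrite addrACA scalerDr.
Qed.

HB.instance Definition _ g (r : g ⊗ g) := GRing.isLinear.Build K g (g ⊗ g)%type *:%R
  (delta_r r) (delta_r_linear r).

Record is_lie_coalgebra (V : lmodType K) (delta : {linear V -> (V ⊗ V)%type}) : Prop := {
  cobracket_antisym : forall x, delta x = - tflip (delta x);
  cobracket_cojacobi : forall x,
    let w := tmap idfun delta (delta x) in w + trot w + trot (trot w) = 0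
}.

Record is_lie_bialgebra g (delta : {linear g -> (g ⊗ g)%type}) : Prop := {
  bialg_coalg : is_lie_coalgebra delta;
  bialg_cocycle : forall x y, delta ⁅x, y⁆ =
    (tmap (ad x) idfun (delta y) + tmap idfun (ad x) (delta y))
    - (tmap (ad y) idfun (delta x) + tmap idfun (ad y) (delta x))
}.

Definition is_quasitriangular g (delta : {linear g -> (g ⊗ g)%type}) : Prop :=
  exists r : g ⊗ g,
    [/\ is_classical_rmatrix r, has_invariant_sym r & delta =1 delta_r r].

Record is_cr_coherent g h (rg : g ⊗ g) (rh : h ⊗ h)
    (phi : {linear g -> h}) (psi : {linear h -> g}) : Prop := {
  cr_coh_hom : is_lie_hom phi;
  cr_coh_l : tmap psi idfun rh = tmap idfun phi rg;
  cr_coh_r : tmap idfun psi rh = tmap phi idfun rg;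
  cr_coh_lie : forall (x : g) (y : h), psi ⁅phi x, y⁆ = ⁅x, psi y⁆
}.

Record is_lb_coherent g h (dg : {linear g -> (g ⊗ g)%type}) (dh : {linear h -> (h ⊗ h)%type})
    (phi : {linear g -> h}) (psi : {linear h -> g}) : Prop := {
  lb_coh_hom : is_lie_hom phi;
  lb_coh_psi : forall y, tmap psi psi (dh y) = dg (psi y);
  lb_coh_phi : forall x, tmap idfun phi (dg x) = tmap psi idfun (dh (phi x));
  lb_coh_lie : forall (x : g) (y : h), psi ⁅phi x, y⁆ = ⁅x, psi y⁆
}.

End LieDefs.

Section LieTheory.
Variable K : fieldType.

Lemma tens_ext2 (U V U' V' W : lmodType K) (f h : U ⊗ V -> U' ⊗ V' -> W) :
  (forall s, linear (f^~ s)) -> (forall r, linear (f r)) ->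
  (forall s, linear (h^~ s)) -> (forall r, linear (h r)) ->
  (forall a b c d, f (a ⊗ b) (c ⊗ d) = h (a ⊗ b) (c ⊗ d)) ->
  forall r s, f r s = h r s.
Proof.
move=> fl fr hl hr fh r s; apply: (tens_ext (fl s) (hl s)) => a b.
by apply: (tens_ext (fr _) (hr _)) => c d.
Qed.

Let lin_add (U W : lmodType K) (f h : U -> W) :
  linear f -> linear h -> linear (fun x => f x + h x).
Proof. by move=> fl hl k x y; rewrite fl hl scalerDr addrACA. Qed.

Let lin_opp (U W : lmodType K) (f : U -> W) :
  linear f -> linear (fun x => - f x).
Proof. by move=> fl k x y; rewrite fl opprD scalerN. Qed.

Section Brackets.
Variable g : lieAlgType K.
Implicit Types (x y z a b c d : g) (r s t p : (g ⊗ g)%type).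

Lemma lieDl x y z : ⁅x + y, z⁆ = ⁅x, z⁆ + ⁅y, z⁆.
Proof. by have := lie_linearl z 1 x y; rewrite !scale1r. Qed.

Lemma lieDr x y z : ⁅z, x + y⁆ = ⁅z, x⁆ + ⁅z, y⁆.
Proof. by have := lie_linearr z 1 x y; rewrite !scale1r. Qed.

Lemma lieC x y : ⁅x, y⁆ = - ⁅y, x⁆.
Proof.
have := liexx (x + y); rewrite lieDl !lieDr !liexx add0r addr0 => /eqP.
by rewrite addr_eq0 => /eqP.
Qed.

Lemma lieNr x y : ⁅x, - y⁆ = - ⁅x, y⁆.
Proof. exact: (linearN (ad x)). Qed.

Lemma lie_der x y z : ⁅x, ⁅y, z⁆⁆ = ⁅⁅x, y⁆, z⁆ + ⁅y, ⁅x, z⁆⁆.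
Proof.
have /eqP := lie_jacobi x y z; rewrite -addrA addr_eq0 => /eqP ->.
by rewrite (lieC z x) lieNr (lieC z ⁅x, y⁆) opprD !opprK addrC.
Qed.

Local Ltac lin :=
  repeat (let x := fresh in intro x); rewrite ?lie_linearl ?lie_linearr;
  by rewrite ?(linearP, tens_linearl).

Lemma br12_13_tens a b c d : br12_13 (a ⊗ b) (c ⊗ d) = ⁅a, c⁆ ⊗ b ⊗ d.
Proof. by rewrite /br12_13 tlift2_tens; lin. Qed.

Lemma br12_13_linearl s : linear ((@br12_13 _ g)^~ s).
Proof. by apply: tlift2_linearl; lin. Qed.

Lemma br12_13_linearr r : linear (br12_13 r).
Proof. by apply: tlift2_linearr; lin. Qed.

Lemma br13_23_tens a b c d : br13_23 (a ⊗ b) (c ⊗ d) = a ⊗ c ⊗ ⁅b, d⁆.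
Proof. by rewrite /br13_23 tlift2_tens; lin. Qed.

Lemma br13_23_linearl s : linear ((@br13_23 _ g)^~ s).
Proof. by apply: tlift2_linearl; lin. Qed.

Lemma br13_23_linearr r : linear (br13_23 r).
Proof. by apply: tlift2_linearr; lin. Qed.

Lemma br12_23_tens a b c d : br12_23 (a ⊗ b) (c ⊗ d) = a ⊗ ⁅b, c⁆ ⊗ d.
Proof. by rewrite /br12_23 tlift2_tens; lin. Qed.

Lemma br12_23_linearl s : linear ((@br12_23 _ g)^~ s).
Proof. by apply: tlift2_linearl; lin. Qed.

Lemma br12_23_linearr r : linear (br12_23 r).
Proof. by apply: tlift2_linearr; lin. Qed.

HB.instance Definition _ r :=
  GRing.isLinear.Build K (g ⊗ g)%type (g ⊗ g ⊗ g)%type *:%R (br12_13 r)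
    (br12_13_linearr r).
HB.instance Definition _ r :=
  GRing.isLinear.Build K (g ⊗ g)%type (g ⊗ g ⊗ g)%type *:%R (br13_23 r)
    (br13_23_linearr r).
HB.instance Definition _ r :=
  GRing.isLinear.Build K (g ⊗ g)%type (g ⊗ g ⊗ g)%type *:%R (br12_23 r)
    (br12_23_linearr r).

Lemma delta_r_linearl x : linear ((@delta_r K g)^~ x).
Proof. by move=> k r s; rewrite /delta_r !linearP !scalerDr addrACA. Qed.

Lemma delta_r_tens a b x : delta_r (a ⊗ b) x = a ⊗ ⁅x, b⁆ + ⁅x, a⁆ ⊗ b.
Proof. by rewrite /delta_r !tmap_tens. Qed.

Let brE := (br12_13_tens, br13_23_tens, br12_23_tens).
Let brL := (br12_13_linearl, br13_23_linearl, br12_23_linearl, delta_r_linearl).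

Lemma tmap_delta_r p r :
  tmap idfun (delta_r r) p = br13_23 p r + br12_23 p r.
Proof.
move: p r; apply: tens_ext2.
- by move=> s k x y; rewrite linearP.
- move=> r k s t; move: r.
  suff: (fun r => tmap idfun (delta_r (k *: s + t)) r) =1
    (fun r => k *: tmap idfun (delta_r s) r + tmap idfun (delta_r t) r) by apply.
  apply: tens_ext => [||a b]; first exact: tmap_linear.
    by move=> l x y; rewrite !tmap_linear !scalerDr !scalerA mulrC addrACA.
  by rewrite !tmap_tens /= delta_r_linearl linearP.
- by move=> s; apply: lin_add => k x y; rewrite brL.
- by move=> s; apply: lin_add => k x y; rewrite linearP.
by move=> a b c d; rewrite tmap_tens /= delta_r_tens !brE linearD.
Qed.

Lemma trot_br13_23 p r :
  trot (br13_23 p r) = br12_13 (tflip p) (tflip r).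
Proof.
move: p r; apply: tens_ext2 => [s k x y|s k x y|s k x y|s k x y|a b c d];
  rewrite ?(brL, linearP) ?linearP ?brL //.
by rewrite !tflip_tens !brE trot_tens.
Qed.

Lemma tensNl (U V : lmodType K) (u : U) (v : V) : (- u) ⊗ v = - (u ⊗ v).
Proof. by rewrite -scaleN1r tensZl scaleN1r. Qed.

Lemma trot2_br13_23 p r :
  trot (trot (br13_23 p r)) = - br12_23 r (tflip p).
Proof.
move: p r; apply: (tens_ext2 (f := fun p r => trot (trot (br13_23 p r)))
  (h := fun p r => - br12_23 r (tflip p)))
  => [s k x y|s k x y|s|s|a b c d].
- by rewrite brL !linearP.
- by rewrite !linearP.
- by apply: lin_opp => k x y; rewrite !linearP.
- by apply: lin_opp => k x y; rewrite brL.
by rewrite tflip_tens !brE !trot_tens lieC tensNl linearN.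
Qed.

Lemma trot_br12_23 p r : trot (br12_23 p r) = - br13_23 (tflip r) p.
Proof.
move: p r; apply: (tens_ext2 (f := fun p r => trot (br12_23 p r))
  (h := fun p r => - br13_23 (tflip r) p)) => [s k x y|s k x y|s|s|a b c d].
- by rewrite brL !linearP.
- by rewrite !linearP.
- by apply: lin_opp => k x y; rewrite !linearP.
- by apply: lin_opp => k x y; rewrite linearP brL.
by rewrite tflip_tens !brE !trot_tens lieC !linearN.
Qed.

Lemma trot2_br12_23 p r : trot (trot (br12_23 p r)) = - br12_13 r (tflip p).
Proof.
move: p r; apply: (tens_ext2 (f := fun p r => trot (trot (br12_23 p r)))
  (h := fun p r => - br12_13 r (tflip p))) => [s k x y|s k x y|s|s|a b c d].
- by rewrite brL !linearP.
- by rewrite !linearP.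
- by apply: lin_opp => k x y; rewrite !linearP.
- by apply: lin_opp => k x y; rewrite brL.
by rewrite tflip_tens !brE !trot_tens lieC tensNl.
Qed.

Let act3 x (w : (g ⊗ g ⊗ g)%type) :=
  tmap (ad x) idfun w + (tmap idfun (tmap (ad x) idfun) w
                         + tmap idfun (tmap idfun (ad x)) w).

Let act3_lin x : linear (act3 x).
Proof. by do ?apply: lin_add; apply: tmap_linear. Qed.

Let act3_tens x a b c :
  act3 x (a ⊗ b ⊗ c) = ⁅x, a⁆ ⊗ b ⊗ c + (a ⊗ ⁅x, b⁆ ⊗ c + a ⊗ b ⊗ ⁅x, c⁆).
Proof. by rewrite /act3 !tmap_tens /= !tmap_tens. Qed.

Let tE := (tensDl, tensDr, lieDl, lieDr).

Let br12_13Dl s r t : br12_13 (r + t) s = br12_13 r s + br12_13 t s.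
Proof. by rewrite -[r in LHS]scale1r brL scale1r. Qed.

Let br13_23Dl s r t : br13_23 (r + t) s = br13_23 r s + br13_23 t s.
Proof. by rewrite -[r in LHS]scale1r brL scale1r. Qed.

Let br12_23Dl s r t : br12_23 (r + t) s = br12_23 r s + br12_23 t s.
Proof. by rewrite -[r in LHS]scale1r brL scale1r. Qed.

Let brDl := (br12_13Dl, br13_23Dl, br12_23Dl).

Lemma act_br12_13 x r s :
  br12_13 (delta_r r x) s + br12_13 r (delta_r s x) = act3 x (br12_13 r s).
Proof.
move: r s; apply: tens_ext2 => [s|r|s k y z|s k y z|a b c d].
- by apply: lin_add => k y z; rewrite !brL.
- by apply: lin_add => k y z; rewrite ?brL linearP.
- by rewrite brL act3_lin.
- by rewrite linearP act3_lin.
rewrite !delta_r_tens !brDl !linearD /= !brE act3_tens (lie_der x a c) !tE.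
by rewrite (AC (2*2) ((2*4)*(1*3)))%AC.
Qed.

Lemma act_br13_23 x r s :
  br13_23 (delta_r r x) s + br13_23 r (delta_r s x) = act3 x (br13_23 r s).
Proof.
move: r s; apply: tens_ext2 => [s|r|s k y z|s k y z|a b c d].
- by apply: lin_add => k y z; rewrite !brL.
- by apply: lin_add => k y z; rewrite ?brL linearP.
- by rewrite brL act3_lin.
- by rewrite linearP act3_lin.
rewrite !delta_r_tens !brDl !linearD /= !brE act3_tens (lie_der x b d) !tE.
by rewrite (AC (2*2) (2*(4*(1*3))))%AC.
Qed.

Lemma act_br12_23 x r s :
  br12_23 (delta_r r x) s + br12_23 r (delta_r s x) = act3 x (br12_23 r s).
Proof.
move: r s; apply: tens_ext2 => [s|r|s k y z|s k y z|a b c d].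
- by apply: lin_add => k y z; rewrite !brL.
- by apply: lin_add => k y z; rewrite ?brL linearP.
- by rewrite brL act3_lin.
- by rewrite linearP act3_lin.
rewrite !delta_r_tens !brDl !linearD /= !brE act3_tens (lie_der x b c) !tE.
by rewrite (AC (2*2) (2*((1*4)*3)))%AC.
Qed.


Lemma flip_delta_r r x : tflip (delta_r r x) = delta_r (tflip r) x.
Proof.
move: r; apply: tens_ext => [k y z|k y z|a b].
- by rewrite !(brL, linearP).
- by rewrite linearP brL.
by rewrite tflip_tens !delta_r_tens linearD /= !tflip_tens addrC.
Qed.

Lemma delta_rDl r s x : delta_r (r + s) x = delta_r r x + delta_r s x.
Proof. by rewrite -[r in LHS]scale1r brL scale1r. Qed.

Lemma br_invariant t p : (forall x, delta_r t x = 0) ->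
  br12_13 p t = br13_23 t (tflip p).
Proof.
move=> t0; move: p; apply: tens_ext => [k x y|k x y|u v].
- by rewrite brL.
- by rewrite !linearP.
pose M (s : (g ⊗ g)%type) : (g ⊗ g ⊗ g)%type := tlift (fun a b => a ⊗ v ⊗ b) s.
have Ml1 b : linear (fun a : g => a ⊗ v ⊗ b) by move=> k x y; apply: tens_linearl.
have Ml2 a : linear (fun b : g => a ⊗ v ⊗ b) by move=> k x y; rewrite !linearP.
have Ml : linear M by apply: tlift_linear.
have MD r s : M (r + s) = M r + M s by rewrite -[r in LHS]scale1r Ml scale1r.
have MT a b : M (a ⊗ b) = a ⊗ v ⊗ b by apply: tlift_tens.
have M0 : M 0 = 0 by apply: (addrI (M 0)); rewrite -MD !addr0.
apply/eqP; rewrite -subr_eq0 tflip_tens -M0 -(t0 u); apply/eqP.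
move: (t); apply: tens_ext => [||a b].
- apply: lin_add => [k x y|]; first by rewrite linearP.
  by apply: lin_opp => k x y; rewrite brL.
- by move=> k x y; rewrite brL Ml.
by rewrite !brE delta_r_tens MD !MT (lieC b) !linearN opprK addrC.
Qed.

Lemma has_invariant_symP r :
  has_invariant_sym r <-> forall x, delta_r (r + tflip r) x = 0.
Proof. by split=> h x; have := h x; rewrite /delta_r addrC. Qed.

Lemma delta_r_lie_bialgebra r :
  is_classical_rmatrix r -> has_invariant_sym r -> is_lie_bialgebra (delta_r r).
Proof.
move=> cybe /has_invariant_symP inv.
have asym x : tflip (delta_r r x) = - delta_r r x.
  by apply/eqP; rewrite -addr_eq0 flip_delta_r addrC -delta_rDl inv.
split; first split=> x; first by rewrite /= asym opprK.
  rewrite /= !tmap_delta_r; set p := delta_r r x.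
  have : act3 x (br12_13 r r + br13_23 r r + br12_23 r r) = 0.
    by rewrite cybe /act3 !linear0 !addr0.
  have a3D u v : act3 x (u + v) = act3 x u + act3 x v.
    by rewrite -[u in LHS]scale1r act3_lin scale1r.
  rewrite !a3D -act_br12_13 -act_br13_23 -act_br12_23 -/p => h.
  rewrite !linearD /= trot2_br13_23 trot2_br12_23 trot_br13_23 trot_br12_23.
  rewrite [tflip p]asym -/p !linearN /= !opprK.
  have -> : br12_13 (- p) (tflip r) = - br12_13 p (tflip r).
    by apply/eqP; rewrite -addr_eq0 -brDl addNr; apply/eqP;
       apply: (addrI (br12_13 0 (tflip r))); rewrite -brDl !addr0.
  have e : - br12_13 p (tflip r) - br13_23 (tflip r) p
         = br12_13 p r + br13_23 r p.
    have := br_invariant p inv; rewrite linearD /= brDl [tflip p]asym -/p.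
    rewrite !linearN /= -opprD.
    move: (br12_13 p r) (br12_13 p (tflip r)) (br13_23 r p) (br13_23 (tflip r) p)
      => X Y Z T e.
    have -> : Y = - (Z + T) - X by rewrite -e [X + Y]addrC addrK.
    by rewrite opprB opprK addrA addrK.
  by rewrite e -h (AC ((2*2)*2) (((3*6)*(1*4))*(2*5)))%AC.
move=> x y.
suff: (fun s => delta_r s ⁅x, y⁆) =1 (fun s =>
    tmap (ad x) idfun (delta_r s y) + tmap idfun (ad x) (delta_r s y)
    - (tmap (ad y) idfun (delta_r s x) + tmap idfun (ad y) (delta_r s x))).
  by apply.
apply: tens_ext => [k a b||a b]; first by rewrite brL.
  apply: lin_add; last apply: lin_opp;
    by apply: lin_add => k a b; rewrite brL linearP.
rewrite !delta_r_tens !linearD /= !tmap_tens /= /ad.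
rewrite !(lie_der x y) !tE -!opprD; apply/eqP; rewrite eq_sym subr_eq.
by rewrite (AC ((1*2)*(2*1)) ((4*2)*((6*3)*(5*1))))%AC.
Qed.

End Brackets.
End LieTheory.

Record category := Category {
  cobj :> Type;
  chom : cobj -> cobj -> Type;
  cid : forall a, chom a a;
  ccomp : forall a b c, chom b c -> chom a b -> chom a c;
  ccomp1l : forall a b (f : chom a b), ccomp (cid b) f = f;
  ccomp1r : forall a b (f : chom a b), ccomp f (cid a) = f;
  ccompA : forall a b c d (f : chom a b) (g : chom b c) (h : chom c d),
    ccomp h (ccomp g f) = ccomp (ccomp h g) f
}.

Definition full_subcategory (C : category) (P : C -> Prop) : category :=
  @Category {a : C | P a} (fun a b => chom (sval a) (sval b))
    (fun a => cid (sval a)) (fun a b c f g => ccomp f g)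
    (fun a b => @ccomp1l C _ _) (fun a b => @ccomp1r C _ _)
    (fun a b c d => @ccompA C _ _ _ _).

(* [Fm] is the action on morphisms of a functor acting by [F] on objects. *)
Definition is_functor (C D : category) (F : C -> D)
    (Fm : forall a b, chom a b -> chom (F a) (F b)) : Prop :=
  (forall a, Fm a a (cid a) = cid (F a)) /\
  (forall a b c (f : chom a b) (g : chom b c),
    Fm a c (ccomp g f) = ccomp (Fm b c g) (Fm a b f)).

Lemma linear_ext (K : fieldType) (U V : lmodType K) (f g : {linear U -> V}) :
  f =1 g -> f = g.
Proof.
case: f g => [f cf] [g cg] /= /funext e; case: g / e in cg *.
case: cf cg => [[a] [b]] [[c] [d]].
by rewrite (Prop_irrelevance a c) (Prop_irrelevance b d).
Qed.

Section TmapComp.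
Variable K : fieldType.

Lemma tmap_comp (U U' U'' V V' V'' : lmodType K) (f : {linear U -> U'})
    (f' : {linear U' -> U''}) (g : {linear V -> V'}) (g' : {linear V' -> V''})
    (F : {linear U -> U''}) (G : {linear V -> V''}) x :
  F =1 f' \o f -> G =1 g' \o g -> tmap F G x = tmap f' g' (tmap f g x).
Proof.
move=> eF eG; move: x; apply: tens_ext => [|k x y|u v].
- exact: tmap_linear.
- by rewrite !linearP.
by rewrite !tmap_tens eF eG.
Qed.

Lemma tmap_swap (U U' V V' : lmodType K) (f : {linear U -> U'})
    (g : {linear V -> V'}) x :
  tmap f idfun (tmap idfun g x) = tmap idfun g (tmap f idfun x).
Proof. by rewrite -!(tmap_comp (F := f) (G := g)). Qed.

Lemma tmap_id (U V : lmodType K) (x : U ⊗ V) : tmap idfun idfun x = x.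
Proof.
by move: x; apply: tens_ext => [|//|u v]; [apply: tmap_linear|rewrite tmap_tens].
Qed.

End TmapComp.

Section Categories.
Variable K : fieldType.

Lemma cr_coherent_id (g : lieAlgType K) (r : g ⊗ g) :
  is_cr_coherent r r idfun idfun.
Proof. by split=> //; rewrite !tmap_id. Qed.

Lemma cr_coherent_comp (g1 g2 g3 : lieAlgType K)
    (r1 : g1 ⊗ g1) (r2 : g2 ⊗ g2) (r3 : g3 ⊗ g3)
    (phi1 : {linear g1 -> g2}) (psi1 : {linear g2 -> g1})
    (phi2 : {linear g2 -> g3}) (psi2 : {linear g3 -> g2}) :
  is_cr_coherent r1 r2 phi1 psi1 -> is_cr_coherent r2 r3 phi2 psi2 ->
  is_cr_coherent r1 r3 (phi2 \o phi1) (psi1 \o psi2).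
Proof.
case=> h1 l1 rr1 m1 [h2 l2 rr2 m2]; split=> [x y|||x y] /=.
- by rewrite h1 h2.
- rewrite (tmap_comp (f := psi2) (f' := psi1) (g := idfun) (g' := idfun)) // l2.
  rewrite (tmap_comp (f := idfun) (f' := idfun) (g := phi1) (g' := phi2)) // -l1.
  by rewrite tmap_swap.
- rewrite (tmap_comp (f := idfun) (f' := idfun) (g := psi2) (g' := psi1)) // rr2.
  rewrite (tmap_comp (f := phi1) (f' := phi2) (g := idfun) (g' := idfun)) // -rr1.
  by rewrite tmap_swap.
- by rewrite m2 m1.
Qed.

Lemma lb_coherent_id (g : lieAlgType K) (d : {linear g -> (g ⊗ g)%type}) :
  is_lb_coherent d d idfun idfun.
Proof. by split=> // x; rewrite tmap_id. Qed.

Lemma lb_coherent_comp (g1 g2 g3 : lieAlgType K)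
    (d1 : {linear g1 -> (g1 ⊗ g1)%type}) (d2 : {linear g2 -> (g2 ⊗ g2)%type})
    (d3 : {linear g3 -> (g3 ⊗ g3)%type})
    (phi1 : {linear g1 -> g2}) (psi1 : {linear g2 -> g1})
    (phi2 : {linear g2 -> g3}) (psi2 : {linear g3 -> g2}) :
  is_lb_coherent d1 d2 phi1 psi1 -> is_lb_coherent d2 d3 phi2 psi2 ->
  is_lb_coherent d1 d3 (phi2 \o phi1) (psi1 \o psi2).
Proof.
case=> h1 p1 f1 m1 [h2 p2 f2 m2]; split=> [x y|y|x|x y] /=.
- by rewrite h1 h2.
- by rewrite (tmap_comp (f := psi2) (f' := psi1) (g := psi2) (g' := psi1)) // p2 p1.
- rewrite (tmap_comp (f := psi2) (f' := psi1) (g := idfun) (g' := idfun)) // -f2.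
  rewrite (tmap_comp (f := idfun) (f' := idfun) (g := phi1) (g' := phi2)) // f1.
  by rewrite tmap_swap.
- by rewrite m2 m1.
Qed.

Record cr_obj := CrObj {
  cr_alg : fdLieAlgType K;
  cr_r : cr_alg ⊗ cr_alg;
  cr_rP : is_classical_rmatrix cr_r
}.

Record cr_hom (a b : cr_obj) := CrHom {
  cr_phi : {linear cr_alg a -> cr_alg b};
  cr_psi : {linear cr_alg b -> cr_alg a};
  cr_homP : is_cr_coherent (cr_r a) (cr_r b) cr_phi cr_psi
}.

Lemma cr_hom_ext a b (f f' : cr_hom a b) :
  cr_phi f =1 cr_phi f' -> cr_psi f =1 cr_psi f' -> f = f'.
Proof.
case: f f' => [p q c] [p' q' c'] /= /linear_ext e1 /linear_ext e2.
by case: _ / e1 in c' *; case: _ / e2 in c' *; rewrite (Prop_irrelevance c c').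
Qed.

Definition cr_id a : cr_hom a a := CrHom (cr_coherent_id (cr_r a)).

Definition cr_comp a b c (f : cr_hom b c) (e : cr_hom a b) : cr_hom a c :=
  CrHom (cr_coherent_comp (cr_homP e) (cr_homP f)).

Fact cr_comp1l a b (f : cr_hom a b) : cr_comp (cr_id b) f = f.
Proof. exact: cr_hom_ext. Qed.

Fact cr_comp1r a b (f : cr_hom a b) : cr_comp f (cr_id a) = f.
Proof. exact: cr_hom_ext. Qed.

Fact cr_compA a b c d (f : cr_hom a b) (e : cr_hom b c) (k : cr_hom c d) :
  cr_comp k (cr_comp e f) = cr_comp (cr_comp k e) f.
Proof. exact: cr_hom_ext. Qed.

Definition Cr : category := Category cr_comp1l cr_comp1r cr_compA.

Definition Crs : category :=
  full_subcategory (fun a : Cr => has_invariant_sym (cr_r a)).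

(* Unlike in [Cr], the Lie algebras underlying the objects of [LB] may be
   infinite-dimensional. *)
Record lb_obj := LbObj {
  lb_alg : lieAlgType K;
  lb_delta : {linear lb_alg -> (lb_alg ⊗ lb_alg)%type};
  lb_deltaP : is_lie_bialgebra lb_delta
}.

Record lb_hom (a b : lb_obj) := LbHom {
  lb_phi : {linear lb_alg a -> lb_alg b};
  lb_psi : {linear lb_alg b -> lb_alg a};
  lb_homP : is_lb_coherent (lb_delta a) (lb_delta b) lb_phi lb_psi
}.

Lemma lb_hom_ext a b (f f' : lb_hom a b) :
  lb_phi f =1 lb_phi f' -> lb_psi f =1 lb_psi f' -> f = f'.
Proof.
case: f f' => [p q c] [p' q' c'] /= /linear_ext e1 /linear_ext e2.
by case: _ / e1 in c' *; case: _ / e2 in c' *; rewrite (Prop_irrelevance c c').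
Qed.

Definition lb_id a : lb_hom a a := LbHom (lb_coherent_id (lb_delta a)).

Definition lb_comp a b c (f : lb_hom b c) (e : lb_hom a b) : lb_hom a c :=
  LbHom (lb_coherent_comp (lb_homP e) (lb_homP f)).

Fact lb_comp1l a b (f : lb_hom a b) : lb_comp (lb_id b) f = f.
Proof. exact: lb_hom_ext. Qed.

Fact lb_comp1r a b (f : lb_hom a b) : lb_comp f (lb_id a) = f.
Proof. exact: lb_hom_ext. Qed.

Fact lb_compA a b c d (f : lb_hom a b) (e : lb_hom b c) (k : lb_hom c d) :
  lb_comp k (lb_comp e f) = lb_comp (lb_comp k e) f.
Proof. exact: lb_hom_ext. Qed.

Definition LB : category := Category lb_comp1l lb_comp1r lb_compA.

Definition QTLB : category :=
  full_subcategory (fun a : LB => is_quasitriangular (lb_delta a)).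

Definition lb_of_r (a : Crs) : LB :=
  LbObj (delta_r_lie_bialgebra (cr_rP (sval a)) (svalP a)).

Lemma lb_of_r_quasitriangular (a : Crs) :
  is_quasitriangular (lb_delta (lb_of_r a)).
Proof.
exists (cr_r (sval a)); split=> //; [exact: cr_rP | exact: svalP a].
Qed.

Definition qtlb_of_r (a : Crs) : QTLB :=
  exist _ (lb_of_r a) (lb_of_r_quasitriangular a).

End Categories.

(* Main.v *)
(* Coherence says that psi (x) id and id (x) phi (and the mirrored pair) exchange
   r_h and r_g, while psi intertwines ad (phi x) with ad x and, by
   antisymmetry, psi \o ad y \o phi = ad (psi y).  Applying these to the two
   summands of delta_r moves every adjoint action from h to g. *)

Require Import Defs.
From mathcomp Require Import all_boot all_order all_algebra.

Set Implicit Arguments.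
Unset Strict Implicit.
Unset Printing Implicit Defensive.

Import GRing.Theory.
Local Open Scope ring_scope.

Section CoherentDelta.
Variables (K : fieldType) (g h : lieAlgType K) (rg : g ⊗ g) (rh : h ⊗ h).
Variables (phi : {linear g -> h}) (psi : {linear h -> g}).

Lemma coherent_lie_phi (y : h) : is_cr_coherent rg rh phi psi ->
  forall x, psi ⁅y, phi x⁆ = ⁅psi y, x⁆.
Proof.
by move=> [_ _ _ psi_lie] x; rewrite lieC linearN psi_lie -lieC.
Qed.

Lemma delta_r_coherent : is_cr_coherent rg rh phi psi ->
  is_lb_coherent (delta_r rg) (delta_r rh) phi psi.
Proof.
move=> coh; have [phi_lie psi_rh_l psi_rh_r psi_lie] := coh.
split=> // [y|x]; rewrite /= /delta_r !linearD /=.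
  congr (_ + _).
    (* Apply [psi] on the left first: the exchange rule turns [rh] into [rg] and leaves
       [psi \o ad y \o phi] on the right factor. *)
    rewrite -(tmap_comp (F := psi) (G := psi \o ad y)) //.
    rewrite (tmap_comp (f := psi) (f' := idfun) (g := idfun)
               (g' := psi \o ad y)) // psi_rh_l.
    by rewrite -(tmap_comp (F := idfun) (G := ad (psi y))) // => z;
       rewrite /= /ad coherent_lie_phi.
  (* The mirrored summand uses the other exchange rule. *)
  rewrite -(tmap_comp (F := psi \o ad y) (G := psi)) //.
  rewrite (tmap_comp (f := idfun) (f' := psi \o ad y) (g := psi)
             (g' := idfun)) // psi_rh_r.
  by rewrite -(tmap_comp (F := ad (psi y)) (G := idfun)) // => z;
     rewrite /= /ad coherent_lie_phi.
congr (_ + _).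
  (* Here [ad] acts on the factor carrying [phi], so [phi] being a Lie homomorphism suffices after
     the exchange. *)
  rewrite tmap_swap psi_rh_l -!(tmap_comp (F := idfun) (G := phi \o ad x)) //.
  by move=> z; rewrite /= /ad phi_lie.
(* Now [ad] meets [psi] instead, and the intertwining rule applies. *)
rewrite -tmap_swap -psi_rh_l -!(tmap_comp (F := psi \o ad (phi x)) (G := idfun)) //.
by move=> z; rewrite /= /ad psi_lie.
Qed.

End CoherentDelta.

Theorem theorem3p13 (K : fieldType) :
  (forall (g h : fdLieAlgType K) (rg : g ⊗ g) (rh : h ⊗ h)
      (phi : {linear g -> h}) (psi : {linear h -> g}),
    is_classical_rmatrix rg -> is_classical_rmatrix rh ->
    has_invariant_sym rg -> has_invariant_sym rh ->
    is_cr_coherent rg rh phi psi ->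
    [/\ is_lie_bialgebra (delta_r rg), is_lie_bialgebra (delta_r rh)
      & is_lb_coherent (delta_r rg) (delta_r rh) phi psi]) /\
  (exists Fm : forall a b : Crs K, chom a b -> chom (qtlb_of_r a) (qtlb_of_r b),
    (forall (a b : Crs K) (f : chom a b),
      lb_phi (Fm a b f) = cr_phi f /\ lb_psi (Fm a b f) = cr_psi f) /\
    is_functor Fm).
Proof.
split=> [g h rg rh phi psi cybe_g cybe_h inv_g inv_h coh|].
  split; [exact: delta_r_lie_bialgebra | exact: delta_r_lie_bialgebra |].
  exact: delta_r_coherent.
(* The pair is kept and only its coherence proof changes, so the functor laws hold pointwise. *)
exists (fun a b (f : chom a b) => LbHom (a := lb_of_r a) (b := lb_of_r b)
  (delta_r_coherent (cr_homP f))).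
by split=> //; split=> [a|a b c f e]; apply: lb_hom_ext.
Qed.
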